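(* Let $T$ be a tree on $n\geq 4$ vertices with exactly $p$ leaves, and suppose $T$ is not a star. Let $B$ be any set output by the algorithm described in the context (for any admissible choices made during its execution). Then $B$ has exactly $2(n-p)$ elements, the rows of $\mathrm{Max4PC}_T$ indexed by the elements of $B$ form a basis of the row space of $\mathrm{Max4PC}_T$, and $$\det \mathrm{Max4PC}_T[B,B]=(-1)^{n-p}\,2^{2(n-p-1)}.$$
   Context: For a tree $T$ with vertex set $V$, $|V|=n$, let $d_{x,y}$ denote the distance between vertices $x,y$ in $T$. $\mathrm{Max4PC}_T$ is the $\binom{n}{2}\times\binom{n}{2}$ matrix with rows and columns indexed by the $2$-element subsets of $V$, whose entry in row $\{w,x\}$ and column $\{y,z\}$ is $\max\{d_{w,x}+d_{y,z},\ d_{w,y}+d_{x,z},\ d_{w,z}+d_{x,y}\}$. $M[B,B]$ denotes the principal submatrix of $M$ on rows and columns in $B$. A leaf is a vertex of degree $1$. The line graph $\mathrm{LG}(T)$ has as vertices the edges $\{a,b\}$ of $T$ (which are $2$-element subsets of $V$), two being adjacent iff they share an endpoint. For a graph $G$, a cut vertex is a vertex whose removal increases the number of connected components, and a block is a maximal connected subgraph without a cut vertex of its own. The symmetric difference of two adjacent vertices $\{a,b\},\{b,c\}$ of $\mathrm{LG}(T)$ is the $2$-set $\{a,c\}$. Algorithm. Initialise $G=\mathrm{LG}(T)$, $B=\emptyset$, and a set $N=\emptyset$ (''next starting vertices''). Choose a leaf $\ell$ of $T$ with neighbour $q$ and set the starting vertex $s=\{\ell,q\}$. Then repeat: (Step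 1) Let $B_c$ be the unique block of the current graph $G$ containing $s$ ($s$ is not a cut vertex of $G$). (Step 2) If $B_c$ contains a cut vertex of $G$: choose one such cut vertex $c$ of $G$ in $B_c$; add all other cut vertices of $G$ lying in $B_c$ to $N$; add the two elements $s$ and $s\,\triangle\, c$ (symmetric difference) to $B$; replace $G$ by the graph obtained by deleting all edges of $B_c$ and then deleting all vertices of $B_c$ that are not cut vertices of $G$; set $s=c$ and return to Step 1. (Step 3) If $B_c$ contains no cut vertex of $G$: choose a vertex $c$ of $B_c$ with $c\neq s$; add $s$ and $c$ to $B$; replace $G$ by $G$ minus all vertices of $B_c$; if $N=\emptyset$, output $B$ and stop; otherwise remove some element from $N$, make it the new $s$, and return to Step 1. *)

(* Defs.v *)
From HB Require Import structures.
From mathcomp Require Import all_boot all_order all_algebra.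
Set Implicit Arguments. Unset Strict Implicit. Unset Printing Implicit Defensive.
Import GRing.Theory Num.Theory.

Section TreeDefs.
Variable V : finType.
Variable e : rel V.

Definition is_tree : Prop :=
  [/\ symmetric e, irreflexive e, (forall x y, connect e x y) &
      (forall p : seq V, uniq p -> 2 < size p -> ~~ cycle e p)].

Fixpoint ball (k : nat) (x : V) : {set V} :=
  if k is k'.+1 then ball k' x :|: [set y | [exists z in ball k' x, e z y]]
  else [set x].

(* graph distance: the least k with y in ball k x, i.e. the number of radii
   k < |V| whose ball does not reach y (in a connected graph on V). *)
Definition dist (x y : V) : nat := #|[set k : 'I_#|V| | y \notin ball k x]|.

Definition leaf (x : V) : bool := #|[set y | e x y]| == 1.
Definition nleaves : nat := #|[set x | leaf x]|.
Definition is_star : Prop := exists c, forall v, v != c -> e c v.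

Definition two_sets : {set {set V}} := [set A : {set V} | #|A| == 2].

(* Max4PC entry for rows {w,x} and {y,z}: the maximum of the three sums,
   taken over all orderings of the two pairs (which only permutes the three
   sums, so this is exactly max{d_wx+d_yz, d_wy+d_xz, d_wz+d_xy}). *)
Definition max4pc (A C : {set V}) : nat :=
  \max_(w in A) \max_(x in A | x != w) \max_(y in C) \max_(z in C | z != y)
     maxn (dist w x + dist y z) (maxn (dist w y + dist x z) (dist w z + dist x y)).

Definition Max4PC (R : nzRingType) : 'M[R]_#|two_sets| :=
  \matrix_(i, j) ((max4pc (enum_val i) (enum_val j))%:R)%R.

Definition Max4PC_rows (R : nzRingType) (B : {set {set V}}) : 'M[R]_(#|B|, #|two_sets|) :=
  \matrix_(i, j) ((max4pc (enum_val i) (enum_val j))%:R)%R.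

Definition Max4PC_BB (R : nzRingType) (B : {set {set V}}) : 'M[R]_#|B| :=
  \matrix_(i, j) ((max4pc (enum_val i) (enum_val j))%:R)%R.

Definition tedges : {set {set V}} := [set [set x; y] | x in V, y in V & e x y].

Record graph := Graph { gV : {set {set V}}; gE : {set {set {set V}}} }.

Definition gadj (G : graph) : rel {set V} :=
  fun x y => [&& x \in gV G, y \in gV G & [set x; y] \in gE G].
Definition gconn (G : graph) (x y : {set V}) : bool := connect (gadj G) x y.
Definition ncomp (G : graph) : nat :=
  #|[set [set y in gV G | gconn G x y] | x in gV G]|.
Definition delv (G : graph) (v : {set V}) : graph :=
  Graph (gV G :\ v) [set f in gE G | v \notin f].
Definition cutv (G : graph) (v : {set V}) : bool :=
  (v \in gV G) && (ncomp G < ncomp (delv G v)).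
Definition subgraph (H G : graph) : Prop :=
  [/\ gV H \subset gV G, gE H \subset gE G &
      forall f, f \in gE H -> f \subset gV H].
Definition gconnected (H : graph) : Prop :=
  gV H != set0 /\ forall x y, x \in gV H -> y \in gV H -> gconn H x y.
Definition nocut (H : graph) : Prop := forall v, ~~ cutv H v.
Definition is_block (G H : graph) : Prop :=
  [/\ subgraph H G, gconnected H, nocut H &
      forall H', subgraph H' G -> gconnected H' -> nocut H' ->
        gV H \subset gV H' -> gE H \subset gE H' -> H' = H].
Definition unique_block (G H : graph) (s : {set V}) : Prop :=
  [/\ is_block G H, s \in gV H &
      forall H', is_block G H' -> s \in gV H' -> H' = H].

Definition linegraph : graph :=
  Graph tedges
        [set [set a; b] | a in tedges, b in tedges & (a != b) && (a :&: b != set0)].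

Definition symdiff (A C : {set V}) : {set V} := (A :\: C) :|: (C :\: A).

(* alg_run G B N s Bout : from the current state (G, B, N, s) at Step 1,
   some admissible execution of the algorithm stops with output Bout. *)
Inductive alg_run :
  graph -> {set {set V}} -> {set {set V}} -> {set V} -> {set {set V}} -> Prop :=
| AStep2 (G : graph) (B N : {set {set V}}) (s : {set V}) (H : graph) (c : {set V}) (Bout : {set {set V}}) :
    unique_block G H s ->
    c \in gV H -> cutv G c ->
    alg_run
      (Graph (gV G :\: [set v in gV H | ~~ cutv G v])
             [set f in gE G :\: gE H | [disjoint f & [set v in gV H | ~~ cutv G v]]])
      (B :|: [set s; symdiff s c])
      (N :|: [set v in gV H | cutv G v & v != c])
      c Bout ->
    alg_run G B N s Bout
| AStep3stop (G : graph) (B N : {set {set V}}) (s : {set V}) (H : graph) (c : {set V}) :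
    unique_block G H s ->
    (forall v, v \in gV H -> ~~ cutv G v) ->
    c \in gV H -> c != s -> N = set0 ->
    alg_run G B N s (B :|: [set s; c])
| AStep3cont (G : graph) (B N : {set {set V}}) (s : {set V}) (H : graph) (c s' : {set V}) (Bout : {set {set V}}) :
    unique_block G H s ->
    (forall v, v \in gV H -> ~~ cutv G v) ->
    c \in gV H -> c != s -> s' \in N ->
    alg_run (Graph (gV G :\: gV H) [set f in gE G | [disjoint f & gV H]])
            (B :|: [set s; c]) (N :\ s') s' Bout ->
    alg_run G B N s Bout.

Definition alg_output (B : {set {set V}}) : Prop :=
  exists l q, [/\ leaf l, e l q & alg_run linegraph set0 set0 [set l; q] B].

End TreeDefs.

(* Main.v *)
(** Root the tree at the leaf [r] where the algorithm starts, with neighbour [q],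
and let [k_w(A)] be the number of elements of the pair [A] lying below [w].
Since the sets of descendants are laminar, the maximum of the three sums of the
four-point condition can be taken edge by edge, so that
  [Max4PC(A,C) = sum_w min (s_w, 4 - s_w)], where [s_w = k_w(A) + k_w(C)].
A summand is [k_w(A) + k_w(C)] minus a bilinear form in the indicators
[gam_w = (k_w = 2)] and [bet_w = (k_w = 1)], and [gam_w = 0] when [w <> r] is a
leaf.  Hence [Max4PC = Y K Y^T] for an integer matrix [Y] with two columns per
inner vertex and [det K = (-1)^(n-p) 4^(n-p-1)].  The algorithm visits every
inner vertex [v] once and outputs [{v, par v}] together with [{par v, u}] for an
inner child [u] of [v] or, if there is none, [{v, y}] for a leaf child [y].
Integer combinations of the rows of [Y] at these pairs give all unit vectors, so
this submatrix is unimodular. *)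

Require Import Defs.
From HB Require Import structures.
From mathcomp Require Import all_boot all_order all_algebra.
From mathcomp Require Import zify ring.
Import GRing.Theory Num.Theory.
Set Implicit Arguments. Unset Strict Implicit. Unset Printing Implicit Defensive.

(** * Walks along a relation *)

Lemma connect_exit (T : finType) (R : rel T) (P : pred T) (x y : T) :
  connect R x y -> P x -> ~~ P y -> exists a b, [/\ R a b, P a & ~~ P b].
Proof.
case/connectP=> p; elim: p x => [|z p IH] x /= => [_ -> -> //|].
case/andP=> xz zp ylast Px nPy.
by case Pz: (P z); [apply: (IH z) | exists x, z; rewrite xz Px Pz].
Qed.

Lemma connect_invariant (T : finType) (S : eqType) (R : rel T) (f : T -> S) x y :
  (forall a b, R a b -> f a = f b) -> connect R x y -> f x = f y.
Proof.
move=> fR /connectP[p]; elim: p x => [|z p IH] x /= => [_ -> //|].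
by case/andP=> /fR -> zp yl; apply: IH.
Qed.

(** * Cut vertices *)

Section CutVertices.
Variable V : finType.
Implicit Types (G : graph V) (c x y a b : {set V}).

Lemma gadj_sym G : symmetric (gadj G).
Proof. by move=> x y; rewrite /gadj andbCA setUC. Qed.

Lemma gconn_sym G x y : gconn G x y = gconn G y x.
Proof. exact: (sym_connect_sym (@gadj_sym G)). Qed.

Lemma gadj_delv G c x y : gadj (delv G c) x y = [&& x != c, y != c & gadj G x y].
Proof.
by rewrite /gadj /= !inE !(eq_sym c); case: (x == c); case: (y == c); rewrite //= ?andbF ?andbT.
Qed.

Lemma gconn_delv G c x y : gconn (delv G c) x y -> gconn G x y.
Proof.
apply: connect_sub => a b; rewrite gadj_delv => /and3P[_ _ ab]; exact: connect1.
Qed.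

Definition comp G x := [set y in gV G | gconn G x y].

Lemma comp_eqP G x y : x \in gV G -> y \in gV G -> reflect (comp G x = comp G y) (gconn G x y).
Proof.
move=> xG yG; apply: (iffP idP) => [xy|E].
  apply/setP => z; rewrite !inE; congr (_ && _).
  exact: (same_connect (sym_connect_sym (@gadj_sym G)) xy).
have: y \in comp G y by rewrite inE yG /gconn connect0.
by rewrite -E inE => /andP[].
Qed.

(* The representative of a component of [delv G c] identifies the component of
   [G] containing it; only the value on nonempty [S] matters. *)
Definition rep (S : {set {set V}}) : {set V} := odflt set0 [pick x in S].

Lemma rep_comp G x : x \in gV G -> rep (comp G x) \in gV G /\ gconn G x (rep (comp G x)).
Proof.
move=> xG; rewrite /rep; case: pickP => [y|/(_ x)] /=; first by rewrite inE => /andP.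
by rewrite inE xG /gconn connect0.
Qed.

Lemma ncompE G : ncomp G = #|comp G @: gV G|.
Proof. by []. Qed.

Lemma comp_delv G c x : x \in gV (delv G c) -> comp G (rep (comp (delv G c) x)) = comp G x.
Proof.
move=> xD; have [rD xr] := rep_comp xD; move: (xD) (rD); rewrite !in_setD1 => /andP[_ xG] /andP[_ rG].
by apply/esym/comp_eqP => //; apply: gconn_delv xr.
Qed.

(** Sending a component of [delv G c] to the component of [G] around it stays surjective when the
    component of [b] is left out: whatever [b] reaches is joined to [a] through [c]. Hence
    [delv G c] has strictly more components. *)
Lemma cutv_intro G c a b : gadj G c a -> gadj G c b -> a != c -> b != c ->
  ~~ gconn (delv G c) a b -> cutv G c.
Proof.
move=> ca cb ac bc nab; have /and3P[cG aG _] := ca; have /and3P[_ bG _] := cb.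
have inD x : (x \in gV (delv G c)) = (x != c) && (x \in gV G) by rewrite in_setD1.
rewrite /cutv cG !ncompE /=; set D := delv G c.
pose up (S : {set {set V}}) := comp G (rep S).
have upE x : x \in gV D -> up (comp D x) = comp G x by exact: comp_delv.
have sub : comp G @: gV G \subset up @: (comp D @: gV D :\ comp D b).
  apply/subsetP => _ /imsetP[x xG ->].
  have out y : y \in gV D -> ~~ gconn D y b -> comp G y \in up @: (comp D @: gV D :\ comp D b).
    move=> yD nyb; apply/imsetP; exists (comp D y); last by rewrite upE.
    rewrite in_setD1 imset_f // andbT; apply: contra nyb => /eqP/comp_eqP; apply=> //.
    by rewrite inD bc.
  have xa : gconn G c x -> comp G x \in up @: (comp D @: gV D :\ comp D b).
    move=> cx; have -> : comp G x = comp G a.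
      apply/comp_eqP => //; rewrite gconn_sym in cx.
      exact: connect_trans cx (connect1 ca).
    by apply: out => //; rewrite inD ac.
  have [-> |xc] := eqVneq x c; first by rewrite (_ : comp G c = comp G a) ?out ?inD ?ac //; apply/comp_eqP => //; apply: connect1.
  have [xb|nxb] := boolP (gconn D x b); last by apply: out => //; rewrite inD xc.
  apply: xa; apply: connect_trans (connect1 cb) _.
  by apply: (gconn_delv (c := c)); rewrite gconn_sym.
apply: leq_ltn_trans (subset_leq_card sub) _; apply: leq_ltn_trans (leq_imset_card _ _) _.
by rewrite [X in _ < X](cardsD1 (comp D b)) imset_f // inD bc.
Qed.

(** A walk through [c] enters and leaves by neighbours of [c], so it can be rerouted around [c].
    Thus distinct components of [delv G c] lie in distinct components of [G]. *)
Lemma cutv_elim G c : 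
  (forall a b, a != c -> b != c -> gadj G c a -> gadj G c b -> gconn (delv G c) a b) ->
  ~~ cutv G c.
Proof.
move=> nbr; rewrite /cutv negb_and -leqNgt !ncompE; case cG: (c \in gV G) => //=; set D := delv G c.
have inD x : (x \in gV (delv G c)) = (x != c) && (x \in gV G) by rewrite in_setD1.
(* By induction on the walk: either its end is reached while avoiding [c], or the walk currently
   stands at [c] and some neighbour of [c] is reached while avoiding [c]. *)
have key x y : x != c -> gconn G x y ->
    if y == c then exists2 a, gadj G c a & a != c /\ gconn D x a else gconn D x y.
  move=> xc /connectP[p]; elim/last_ind: p y => [|p z IH] y /=.
    by move=> _ ->; rewrite (negbTE xc) /gconn connect0.
  rewrite rcons_path last_rcons => /andP[pP ez] ->; have := IH _ pP erefl.
  have [zc|zc] := eqVneq z c.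
    rewrite zc in ez; case: eqVneq => [//|lc] xl; exists (last x p) => //.
    by rewrite gadj_sym.
  case: eqVneq => [E|lc].
    case=> a ca [ac xa]; apply: connect_trans xa _; apply: nbr => //.
    by rewrite -E.
  move=> xl; apply: connect_trans xl (connect1 _).
  by rewrite gadj_delv lc zc.
pose up (S : {set {set V}}) := comp G (rep S).
have upE x : x \in gV D -> up (comp D x) = comp G x by exact: comp_delv.
rewrite -(card_in_imset (f := up)); last first.
  move=> _ _ /imsetP[x xD ->] /imsetP[y yD ->]; rewrite !upE //.
  move: (xD) (yD); rewrite !inD => /andP[xc xG] /andP[yc yG] /comp_eqP-/(_ xG yG) xy.
  by apply/comp_eqP => //; have := key x y xc xy; rewrite (negbTE yc).
apply: subset_leq_card; apply/subsetP => _ /imsetP[_ /imsetP[x xD ->] ->].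
by rewrite upE // imset_f //; move: xD; rewrite inD => /andP[].
Qed.

End CutVertices.

(** * Rooted trees *)

Section RootedTree.
Variables (V : finType) (e : rel V) (r : V).
Hypothesis tree_e : is_tree e.

Lemma tree_sym : symmetric e. Proof. by case: tree_e. Qed.
Lemma tree_irr : irreflexive e. Proof. by case: tree_e. Qed.
Lemma tree_connected x y : connect e x y. Proof. by case: tree_e. Qed.

Lemma edge_neq x y : e x y -> x != y.
Proof. by apply: contraTneq => ->; rewrite tree_irr. Qed.

(** Otherwise a simple [R]-path from [x] to [y], closed by the edge between them, is a cycle. It has
    more than two vertices because [R x y] fails. *)
Lemma edge_bridge (R : rel V) x y :
  (forall a b, R a b -> e a b) -> ~~ R x y -> e x y -> ~~ connect R x y.
Proof.
move=> sub nR exy; apply/negP => /connectP[p0 p0P].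
case/shortenP: p0P => p pP upath _ {p0} lasty.
case: tree_e => _ _ _ /(_ (x :: p) upath) acyclic.
have: 2 < size (x :: p).
  case: p pP upath lasty {acyclic} => [|z [|//]] /=.
    by move=> _ _ xy; move: exy; rewrite xy tree_irr.
  by rewrite andbT => Rxz _ yz; rewrite yz Rxz in nR.
move/acyclic; rewrite /= rcons_path -lasty tree_sym exy andbT.
by move/negP; apply; apply: sub_path pP.
Qed.

Lemma ball_reach x : exists k, x \in ball e k r.
Proof.
have /connectP[p] := tree_connected r x.
elim/last_ind: p x => [|p z IH] x; first by move=> _ ->; exists 0; rewrite inE.
rewrite rcons_path last_rcons => /andP[pP ez] ->.
have [k Hk] := IH _ pP erefl; exists k.+1; rewrite !inE; apply/orP; right.
by apply/exists_inP; exists (last r p).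
Qed.

Definition depth x := ex_minn (ball_reach x).
(** The default value is taken only at the root, which becomes its own parent; ancestors are then
    the iterates of a total function. *)
Definition par x := odflt r [pick y | e x y && (depth y < depth x)].

Lemma depth_root : depth r = 0.
Proof.
rewrite /depth; case: ex_minnP => m _ /(_ 0); rewrite inE eqxx => /(_ isT).
by rewrite leqn0 => /eqP.
Qed.

Lemma par_root : par r = r.
Proof. by rewrite /par; case: pickP => //= y; rewrite depth_root ltn0 andbF. Qed.

Lemma par_spec x : x != r -> e x (par x) && (depth (par x) < depth x).
Proof.
move=> xr; rewrite /par; case: pickP => [//|noy] /=.
have: exists y, e x y && (depth y < depth x); last by case=> y; rewrite noy.
rewrite {2}/depth; case: ex_minnP => -[|m]; first by rewrite inE (negbTE xr).
rewrite !inE => /orP[xm /(_ _ xm)|/exists_inP[y ym yx] _]; first by rewrite ltnn.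
exists y; rewrite tree_sym yx /depth; case: ex_minnP => k _ /(_ _ ym); lia.
Qed.

Lemma par_edge x : x != r -> e x (par x).
Proof. by case/par_spec/andP. Qed.
Lemma depth_par x : x != r -> depth (par x) < depth x.
Proof. by case/par_spec/andP. Qed.
Lemma par_neq x : x != r -> par x != x.
Proof. by move/depth_par; apply: contraTneq => ->; rewrite ltnn. Qed.

Definition par_rel : rel V := fun a b => ((a != r) && (b == par a)) || ((b != r) && (a == par b)).

Lemma par_rel_sym a b : par_rel a b = par_rel b a.
Proof. by rewrite /par_rel orbC. Qed.

Lemma par_connect_root x : connect par_rel x r.
Proof.
have [n] := ubnP (depth x); elim: n x => // n IH x dx.
have [->|xr] := eqVneq x r; first exact: connect0.
have dp := depth_par xr; apply: (@connect_trans _ _ (par x)); last by apply: IH; lia.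
by apply: connect1; rewrite /par_rel xr eqxx.
Qed.

(** Parent edges alone already connect any two vertices through the root, so by [edge_bridge] no
    further edge can exist. *)
Lemma edge_parE x y : e x y = par_rel x y.
Proof.
have sub a b : par_rel a b -> e a b.
  by case/orP=> /andP[ar /eqP->]; [|rewrite tree_sym]; exact: par_edge.
apply/idP/idP => [exy|]; last exact: sub.
apply/negP => /negP nxy; have /negP := edge_bridge sub nxy exy; apply.
apply: connect_trans (par_connect_root x) _.
by rewrite (sym_connect_sym par_rel_sym) par_connect_root.
Qed.

Lemma edge_par_cases x y : e x y -> (x != r /\ y = par x) \/ (y != r /\ x = par y).
Proof. by rewrite edge_parE => /orP[] /andP[? /eqP ?]; [left|right]. Qed.

Definition anc w x : bool := fconnect par x w.

Lemma anc_refl x : anc x x. Proof. exact: connect0. Qed.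

Lemma anc_root w : anc w r = (w == r).
Proof.
apply/idP/eqP => [|->]; last exact: anc_refl.
case/iter_findex; elim: (findex _ _ _) => [//|n IH].
by rewrite iterSr par_root.
Qed.

Lemma anc_parE w x : anc w x = (w == x) || anc w (par x).
Proof.
apply/idP/orP => [/iter_findex|[/eqP->|]].
- case: (findex _ _ _) => [<-|n]; first by left.
  by rewrite iterSr => <-; right; apply: fconnect_iter.
- exact: anc_refl.
- by apply: connect_trans; apply: fconnect1.
Qed.

Lemma root_anc x : anc r x.
Proof.
have [n] := ubnP (depth x); elim: n x => // n IH x dx.
have [->|xr] := eqVneq x r; first exact: anc_refl.
by rewrite anc_parE IH ?orbT //; have := depth_par xr; lia.
Qed.

Lemma anc_trans u v w : anc u v -> anc v w -> anc u w.
Proof. by move=> uv vw; apply: connect_trans vw uv. Qed.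

Lemma anc_comparable u v x : anc u x -> anc v x -> anc u v || anc v u.
Proof.
move=> /iter_findex ux /iter_findex vx.
have [le|/ltnW le] := leqP (findex par x u) (findex par x v).
  by apply/orP; right; rewrite -vx -(subnK le) iterD ux; exact: fconnect_iter.
by apply/orP; left; rewrite -ux -(subnK le) iterD vx; exact: fconnect_iter.
Qed.

Lemma anc_depth w x : anc w x -> w != x -> depth w < depth x.
Proof.
have [n] := ubnP (depth x); elim: n x => // n IH x dx.
have [->|xr] := eqVneq x r; first by rewrite anc_root => /eqP ->; rewrite eqxx.
rewrite anc_parE => /orP[/eqP->|]; first by rewrite eqxx.
have dp := depth_par xr; have [-> //|wp wpx _] := eqVneq w (par x).
by have := IH _ _ wpx wp; lia.
Qed.

Lemma anc_par_self x : x != r -> anc x (par x) = false.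
Proof.
move=> xr; apply/negP => /anc_depth; rewrite eq_sym par_neq // => /(_ isT).
by have := depth_par xr; lia.
Qed.

Lemma anc_below y x : anc y x -> y != x -> exists z, [/\ z != r, par z = y & anc z x].
Proof.
have [n] := ubnP (depth x); elim: n x => // n IH x dx.
have [->|xr] := eqVneq x r; first by rewrite anc_root => /eqP ->; rewrite eqxx.
rewrite anc_parE => /orP[/eqP->|]; first by rewrite eqxx.
have dp := depth_par xr; have [-> _ _|wp wpx _] := eqVneq y (par x).
  by exists x; rewrite xr anc_refl.
have [|z [zr zy zx]] := IH _ _ wpx wp; first lia.
by exists z; split=> //; rewrite anc_parE zx orbT.
Qed.

(** * Distances as numbers of separating clades *)

(** The clade of [w] is the set of its descendants, [w] included. A vertex [w] other than [r] stands
    for the edge to its parent, so this set encodes the edges of the path from [x] to [y]; the root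
    never belongs to it. *)
Definition sep x y : {set V} := [set w | anc w x (+) anc w y].

Lemma sep_par x y : y != r -> sep x y =i [pred w | if w == y then ~~ (w \in sep x (par y)) else w \in sep x (par y)].
Proof.
move=> yr w; rewrite !inE (anc_parE w y); case: eqP => [->|//].
by rewrite anc_par_self //= addbT addbF.
Qed.

Lemma card_sep_par x y : y != r ->
  #|sep x y| = if anc y x then #|sep x (par y)|.-1 else #|sep x (par y)|.+1.
Proof.
move=> yr; rewrite (cardsD1 y) [in RHS](cardsD1 y).
have -> : sep x y :\ y = sep x (par y) :\ y.
  by apply/setP => w; rewrite in_setD1 [RHS]in_setD1 sep_par // inE; case: eqP.
rewrite sep_par // !inE eqxx anc_par_self // addbF.
by case: (anc y x).
Qed.

Lemma card_sep_edge x y z : e y z -> #|sep x z| <= #|sep x y|.+1.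
Proof.
case/edge_par_cases=> -[yr ->].
  by rewrite (card_sep_par x yr); case: ifP => _; lia.
by rewrite (card_sep_par x yr); case: ifP => _; lia.
Qed.

Lemma card_sep_closer x y : x != y -> exists2 z, e z y & #|sep x y| = #|sep x z|.+1.
Proof.
move=> xy; have [yx|nyx] := boolP (anc y x).
  have [|z [zr zy zx]] := anc_below yx; first by rewrite eq_sym.
  exists z; first by rewrite edge_parE /par_rel zr zy eqxx.
  rewrite (card_sep_par x zr) zx zy prednK // card_gt0; apply/set0Pn; exists z.
  by rewrite inE zx -zy anc_par_self.
have yr : y != r by apply: contra nyx => /eqP->; exact: root_anc.
exists (par y); first by rewrite tree_sym par_edge.
by rewrite (card_sep_par x yr) (negbTE nyx).
Qed.

(** The size of [sep x y] grows by at most one along an edge, and from every [y] other than [x] some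
    edge decreases it by one. *)
Lemma ball_sep k x y : (y \in ball e k x) = (#|sep x y| <= k).
Proof.
elim: k y => [|k IH] y.
  rewrite inE leqn0; apply/eqP/idP => [->|]; first by rewrite cards_eq0; apply/eqP/setP=> w; rewrite !inE addbb.
  apply: contraTeq; rewrite eq_sym => /card_sep_closer[z _ ->]; lia.
rewrite !inE IH; apply/orP/idP => [[|/exists_inP[z]]|le]; first lia.
  by rewrite IH => zk /(card_sep_edge x); lia.
have [->|xy] := eqVneq x y.
  by left; rewrite (_ : sep y y = set0) ?cards0 //; apply/setP=> w; rewrite !inE addbb.
have [z zy zE] := card_sep_closer xy; right; apply/exists_inP; exists z => //.
by rewrite IH; lia.
Qed.

Lemma distE x y : dist e x y = #|sep x y|.
Proof.
(* This bound ensures that counting only the radii below [#|V|] cuts nothing off. *)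
have lt : #|sep x y| <= #|V|.
  by rewrite -cardsT subset_leq_card // subsetT.
rewrite /dist (_ : [set k | _] = [set k : 'I_#|V| | k < #|sep x y|]); last first.
  by apply/setP=> k; rewrite !inE ball_sep ltnNge.
by rewrite -sum1dep_card -(big_ord_widen _ (fun=> 1) lt) sum1_card card_ord.
Qed.

(** * The four-point maximum, clade by clade *)

Lemma anc_laminar u v x y z :
  anc u x -> anc v x -> anc u y -> anc v z -> ~~ anc v y -> anc u z.
Proof.
move=> ux vx uy vz nvy; case/orP: (anc_comparable ux vx) => [uv|vu].
  exact: anc_trans uv vz.
by rewrite (anc_trans vu uy) in nvy.
Qed.

Lemma dist_sum x y : dist e x y = \sum_w (anc w x (+) anc w y).
Proof.
by rewrite distE -sum1dep_card big_mkcond; apply: eq_bigr => w _; case: (_ (+) _).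
Qed.

(** For each [w] every pairing contributes at most min(k, 4 - k), where k counts the points below
    [w]. The pairing ab, cd falls short only at a [w] separating the pair a, b from the pair c, d.
    If such a [w] exists, laminarity keeps the pairing ac, bd from falling short anywhere. *)
Lemma max_three_sums a b c d :
  maxn (dist e a b + dist e c d) (maxn (dist e a c + dist e b d) (dist e a d + dist e b c))
  = \sum_w minn (anc w a + anc w b + (anc w c + anc w d)) (4 - (anc w a + anc w b + (anc w c + anc w d))).
Proof.
pose s x y z t w := (anc w x (+) anc w y) + (anc w z (+) anc w t).
have sE x y z t : dist e x y + dist e z t = \sum_w s x y z t w.
  by rewrite !dist_sum -big_split.
pose m w := let k := anc w a + anc w b + (anc w c + anc w d) in minn k (4 - k).
rewrite !sE -[RHS]/(\sum_w m w).
have le1 : \sum_w s a b c d w <= \sum_w m w.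
  by apply: leq_sum => w _; rewrite /s /m; do 4!case: (anc w _).
have le2 : \sum_w s a c b d w <= \sum_w m w.
  by apply: leq_sum => w _; rewrite /s /m; do 4!case: (anc w _).
have le3 : \sum_w s a d b c w <= \sum_w m w.
  by apply: leq_sum => w _; rewrite /s /m; do 4!case: (anc w _).
pose split w := [&& anc w a == anc w b, anc w c == anc w d & anc w a != anc w c].
have [/existsP[u us]|nsplit] := boolP [exists u, split u]; last first.
  have eq1 : \sum_w s a b c d w = \sum_w m w.
    apply: eq_bigr => w _; move: nsplit; rewrite negb_exists => /forallP/(_ w).
    by rewrite /split /s /m; do 4!case: (anc w _).
  by rewrite eq1; apply/maxn_idPl; rewrite geq_max le2 le3.
(* Two clades splitting the four points into different pairs would cross. *)
have eq2 : \sum_w s a c b d w = \sum_w m w.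
  apply: eq_bigr => w _; rewrite /s /m.
  case wa: (anc w a); case wb: (anc w b); case wc: (anc w c); case wd: (anc w d) => //=.
  - move: us; rewrite /split; case ua: (anc u a); case ub: (anc u b); case uc: (anc u c); case ud: (anc u d) => //= _.
      by have := anc_laminar ua wa ub wc; rewrite wb uc => /(_ isT).
    by have := anc_laminar uc wc ud wa; rewrite wd ua => /(_ isT).
  - move: us; rewrite /split; case ua: (anc u a); case ub: (anc u b); case uc: (anc u c); case ud: (anc u d) => //= _.
      by have := anc_laminar ub wb ua wd; rewrite wa ud => /(_ isT).
    by have := anc_laminar ud wd uc wb; rewrite wc ub => /(_ isT).
by rewrite eq2; apply/eqP; rewrite eqn_leq !geq_max le1 le3 leqnn !leq_max leqnn !orbT.
Qed.

Definition cnt w (A : {set V}) : nat := \sum_(x in A) anc w x.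

Lemma cnt2 w x y : x != y -> cnt w [set x; y] = anc w x + anc w y.
Proof. by move=> xy; rewrite /cnt big_setU1 ?big_set1 // inE. Qed.

Lemma two_setsE (A : {set V}) x y : A \in two_sets V -> x \in A -> y \in A -> y != x -> A = [set x; y].
Proof.
rewrite inE => /eqP A2 xA yA yx; apply/eqP; rewrite eq_sym eqEcard A2 cards2 eq_sym yx andbT.
by apply/subsetP => z; rewrite !inE => /orP[]/eqP->.
Qed.

Lemma two_sets_split (A : {set V}) : A \in two_sets V ->
  exists x y, [/\ x \in A, y \in A, y != x & A = [set x; y]].
Proof.
move=> A2; have := A2; rewrite inE => /cards2P[x [y [xy E]]].
by exists x, y; rewrite -E; split=> //; rewrite ?E ?inE ?eqxx ?orbT // eq_sym.
Qed.

Lemma bigmax_const (I : finType) (P : pred I) (F : I -> nat) c i0 :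
  P i0 -> (forall i, P i -> F i = c) -> \max_(i | P i) F i = c.
Proof.
move=> Pi0 Fc; apply/eqP; rewrite eqn_leq; apply/andP; split.
  by apply/bigmax_leqP => i /Fc ->.
by rewrite -(Fc _ Pi0) (bigmax_sup i0).
Qed.

Lemma max4pcE A C : A \in two_sets V -> C \in two_sets V ->
  max4pc e A C = \sum_w minn (cnt w A + cnt w C) (4 - (cnt w A + cnt w C)).
Proof.
move=> A2 C2; have [a [b [aA bA ba _]]] := two_sets_split A2.
have [c [d [cC dC dc _]]] := two_sets_split C2.
apply: (bigmax_const aA) => a' a'A.
(* The other element of [A] shows that the inner maximum is over a nonempty range, so it equals the
   common value rather than the default 0. *)
have /andP[bi0 bi1] : ((if a' == a then b else a) \in A) && ((if a' == a then b else a) != a').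
  by case: eqP => [->|/eqP]; rewrite ?bA ?aA //= eq_sym.
apply: (bigmax_const (i0 := if a' == a then b else a)); first by rewrite bi0.
move=> b' /andP[b'A b'a'].
apply: (bigmax_const cC) => c' c'C.
have /andP[di0 di1] : ((if c' == c then d else c) \in C) && ((if c' == c then d else c) != c').
  by case: eqP => [->|/eqP]; rewrite ?dC ?cC //= eq_sym.
apply: (bigmax_const (i0 := if c' == c then d else c)); first by rewrite di0.
move=> d' /andP[d'C d'c'].
rewrite max_three_sums; apply: eq_bigr => w _.
rewrite (two_setsE A2 a'A b'A b'a') (two_setsE C2 c'C d'C d'c').
by rewrite !cnt2 // eq_sym.
Qed.

(** * Rooting at a leaf and factoring the matrix *)

Section LeafRoot.
Variable q : V.
Hypotheses (leaf_r : leaf e r) (e_rq : e r q).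

Definition inner : {set V} := [set x | ~~ leaf e x].

Lemma inner_neighbours v a b : e v a -> e v b -> a != b -> v \in inner.
Proof.
move=> va vb ab; rewrite inE /leaf; apply/negP => /cards1P[c E].
have: a \in [set y | e v y] by rewrite inE.
have: b \in [set y | e v y] by rewrite inE.
by rewrite E !inE => /eqP bc /eqP ac; rewrite ac bc eqxx in ab.
Qed.

Lemma inner_other v a : v \in inner -> e v a -> exists2 b, b != a & e v b.
Proof.
rewrite inE /leaf => nl va; apply/exists_inP; apply: contraR nl => /exists_inPn nob.
apply/cards1P; exists a; apply/setP => b; rewrite !inE.
by apply/idP/eqP => [vb|->//]; apply/eqP; apply: contraTT vb => /nob.
Qed.

Lemma root_not_inner : r \notin inner. Proof. by rewrite inE negbK. Qed.

Lemma inner_root v : v \in inner -> v != r.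
Proof. by apply: contraTneq => ->; exact: root_not_inner. Qed.

Lemma q_root : q != r. Proof. by rewrite eq_sym; exact: edge_neq e_rq. Qed.

Lemma root_neighbour x : e r x -> x = q.
Proof. by move=> rx; apply/eqP; apply: contraT => /(inner_neighbours rx e_rq); rewrite (negbTE root_not_inner). Qed.

Lemma par_q : par q = r.
Proof. by case: (edge_par_cases e_rq) => -[]; rewrite ?eqxx. Qed.

Lemma par_eq_root x : x != r -> par x = r -> x = q.
Proof. by move=> xr pxr; apply: root_neighbour; rewrite tree_sym -pxr par_edge. Qed.

Lemma par_inner x : x != r -> x != q -> par x \in inner.
Proof.
move=> xr xq; have pr : par x != r by apply: contra xq => /eqP/(par_eq_root xr)->.
apply: (@inner_neighbours _ x (par (par x))); rewrite ?par_edge //.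
  by rewrite tree_sym par_edge.
have d1 := depth_par xr; have d2 := depth_par pr.
by apply/eqP => E; rewrite -E in d2; lia.
Qed.

Lemma anc_inner w x : anc w x -> w != x -> w != r -> w \in inner.
Proof.
move=> wx nwx wr; have [z [zr zw _]] := anc_below wx nwx.
rewrite -zw; apply: par_inner => //; apply: contra wr => /eqP zq.
by rewrite -zw zq par_q.
Qed.

Lemma anc_q x : x != r -> anc q x.
Proof.
move=> xr; have [|z [zr zw zx]] := anc_below (root_anc x); first by rewrite eq_sym.
by rewrite -(par_eq_root zr zw).
Qed.

(** If no child of [q] were inner, any vertex at distance at least two from [q] would have an inner
    parent, and the child of [q] on the way to that parent would be inner. So [q] would be the
    centre of a star. *)
Lemma inner_child_q : ~ is_star e -> exists2 h, h \in inner & par h = q.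
Proof.
move=> nstar.
have [/exists_inP[h hi /eqP hq]|/exists_inPn no] := boolP [exists h in inner, par h == q].
  by exists h.
case: nstar; exists q => v vq.
have [->|vr] := eqVneq v r; first by rewrite tree_sym.
have [<-|pvq] := eqVneq (par v) q; first by rewrite tree_sym par_edge.
have pvi := par_inner vr vq; have pvr := inner_root pvi.
have [|z [zr zq zp]] := anc_below (anc_q pvr); first by rewrite eq_sym.
have zi : z \in inner.
  by have [->//|zp'] := eqVneq z (par v); apply: anc_inner zp zp' zr.
by have := no _ zi; rewrite zq eqxx.
Qed.

Definition gam w A : int := (cnt w A == 2)%:Z.
Definition bet w A : int := (cnt w A == 1)%:Z.
(** The part of the four-point maximum that depends on one pair only. Membership of [r] is the
    contribution of the edge between [r] and [q]. *)
Definition lam (A : {set V}) : int := ((r \in A) + \sum_(w | (w != r) && (w != q)) cnt w A)%:Z.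

(* The two columns of [Y] at the inner vertex [w]; as [gam q] and [bet q] are
   determined by membership of [r], the columns at [q] carry the constant and the
   linear part [lam] instead. *)
Definition co1 A w : int := if w == q then 1%R else gam w A.
Definition co2 A w : int := if w == q then lam A else bet w A.
Definition ka w : int := if w == q then 0%R else (-4)%R.
Definition kd w : int := if w == q then 1%R else (-2)%R.

Lemma cnt_r A : A \in two_sets V -> cnt r A = 2.
Proof.
by case/two_sets_split=> x [y [_ _ yx ->]]; rewrite cnt2 1?eq_sym // !root_anc.
Qed.

Lemma cnt_q A : A \in two_sets V -> cnt q A + (r \in A) = 2.
Proof.
have qE x : anc q x = (x != r).
  by have [->|/anc_q] := eqVneq x r; first by rewrite anc_root (negbTE q_root).
case/two_sets_split=> x [y [_ _ yx ->]]; rewrite cnt2 1?eq_sym // !qE !inE.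
rewrite !(eq_sym r); have [xr|xr] := eqVneq x r; last by case: eqP.
by rewrite -xr yx.
Qed.

Lemma cnt_le2 w A : A \in two_sets V -> cnt w A <= 2.
Proof.
case/two_sets_split=> x [y [_ _ yx ->]]; rewrite cnt2 1?eq_sym //.
by do 2!case: (anc w _).
Qed.

Lemma cnt_leaf w A : A \in two_sets V -> w != r -> w \notin inner -> cnt w A <= 1.
Proof.
move=> A2 wr wl; have E x : anc w x -> w = x.
  by move=> wx; apply/eqP; apply: contraR wl => /(anc_inner wx)->.
move: A2 => /two_sets_split[x [y [_ _ yx ->]]]; rewrite cnt2 1?eq_sym //.
case wx: (anc w x); case wy: (anc w y) => //.
by move: yx; rewrite -(E _ wx) -(E _ wy) eqxx.
Qed.

Hypothesis q_inner : q \in inner.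

(** Write s for the sum of the two counts. At [r] it is 4 and the term vanishes; at [q] the term is
    the number of the two pairs containing [r], as all vertices but [r] lie below [q]. Elsewhere
    min(s, 4 - s) is s minus 4 for [gam] times [gam] and minus 2 for each mixed product of [gam] and
    [bet]. The linear parts form [lam A + lam C], which the columns at [q] produce. *)
Lemma max4pc_gram A C : A \in two_sets V -> C \in two_sets V ->
  ((max4pc e A C)%:Z = \sum_(w in inner)
     (ka w * co1 A w * co1 C w + kd w * (co1 A w * co2 C w + co2 A w * co1 C w)))%R.
Proof.
move=> A2 C2; rewrite max4pcE // (bigD1 r) //= !cnt_r // add0n.
rewrite (bigD1 q) ?q_root //= [RHS](bigD1 q) //= /ka /kd /co1 /co2 !eqxx !mul0r add0r !mul1r mulr1.
pose h w := (- 4 * gam w A * gam w C - 2 * (gam w A * bet w C + bet w A * gam w C))%R.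
(* The indices added on the right are leaves other than [r]; there [gam] vanishes, and each product
   in [h] has a factor [gam]. *)
rewrite [X in (lam C + lam A + X)%R](_ : _ = \sum_(w | (w != r) && (w != q)) h w)%R; last first.
  rewrite big_mkcond [RHS]big_mkcond; apply: eq_bigr => w _ /=.
  have [->|wq] := eqVneq w q; first by rewrite !andbF.
  rewrite !andbT; have [wi|nwi] := boolP (w \in inner).
    rewrite (inner_root wi) /h /=; ring.
  have [//|wr] := eqVneq w r; rewrite /h /gam.
  by rewrite /= !(ltn_eqF (_ : cnt w _ < 2)) ?ltnS ?cnt_leaf // /bet !(mulr0, mul0r).
have sumE : ((\sum_(i | (i != r) && (i != q)) minn (cnt i A + cnt i C) (4 - (cnt i A + cnt i C)))%:Z
   = (\sum_(w | (w != r) && (w != q)) cnt w A)%:Z + (\sum_(w | (w != r) && (w != q)) cnt w C)%:Z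
     + \sum_(w | (w != r) && (w != q)) h w)%R.
  rewrite !(big_morph Posz PoszD (erefl _)) -!big_split; apply: eq_bigr => w _ /=.
  rewrite /h /gam /bet; move: (cnt_le2 w A2) (cnt_le2 w C2).
  by case: (cnt w A) (cnt w C) => [|[|[|a]]] // [|[|[|c]]].
rewrite PoszD sumE /lam.
have := cnt_q A2; have := cnt_q C2; case: (r \in A) (r \in C) => -[] /=; lia.
Qed.

(* The possible companions of [[set v; par v]] in the output. *)
Definition branch v (A : {set V}) : Prop :=
  (exists u, [/\ u \in inner, par u = v & A = [set par v; u]]) \/
  ((forall u, u \in inner -> par u <> v) /\
   exists y, [/\ y != r, par y = v, y \notin inner & A = [set v; y]]).

Local Open Scope ring_scope.

(** * Unit vectors as integer combinations of rows *)

Section Lattice.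
Variable B : {set {set V}}.
Hypothesis par_in_B : forall v, v \in inner -> [set v; par v] \in B.
Hypothesis branch_in_B : forall v, v \in inner -> exists2 A, A \in B & branch v A.
Hypothesis q_has_inner : exists2 h, h \in inner & par h = q.

(** The vector with first block [F] and second block [G] lies in the lattice generated by the rows
    of [Y] at [B]; only values at inner vertices count. *)
Definition spanned (F G : V -> int) : Prop := exists u : {set V} -> int,
  forall w, w \in inner ->
    F w = (\sum_(A in B) u A * co1 A w) /\ G w = (\sum_(A in B) u A * co2 A w).

Lemma spanned_ext F G F' G' : spanned F G ->
  (forall w, w \in inner -> F' w = F w /\ G' w = G w) -> spanned F' G'.
Proof. by move=> [u uP] E; exists u => w wi; have [-> ->] := E w wi; exact: uP. Qed.

Lemma spanned_comb c F G F' G' : spanned F G -> spanned F' G' ->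
  spanned (fun w => F w + c * F' w) (fun w => G w + c * G' w).
Proof.
move=> [u uP] [u' uP']; exists (fun A => u A + c * u' A) => w wi.
have [-> ->] := uP w wi; have [-> ->] := uP' w wi.
by rewrite !mulr_sumr -!big_split; split; apply: eq_bigr => A _ /=; rewrite mulrDl mulrA.
Qed.

Lemma spanned_mem A : A \in B -> spanned (co1 A) (co2 A).
Proof.
move=> AB; exists (fun C => (C == A)%:Z) => w wi.
by rewrite !(bigD1 A AB) /= eqxx !mul1r !big1 ?addr0 // => C /andP[_ /negbTE->]; rewrite mul0r.
Qed.

Lemma gam2 w x y : x != y -> gam w [set x; y] = (anc w x && anc w y)%:Z.
Proof. by move=> xy; rewrite /gam cnt2 //; do 2!case: (anc w _). Qed.

Lemma bet2 w x y : x != y -> bet w [set x; y] = (anc w x (+) anc w y)%:Z.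
Proof. by move=> xy; rewrite /bet cnt2 //; do 2!case: (anc w _). Qed.

(** With [u] an inner child of [q], the rows of {r, u} and {u, q} agree except that [lam] differs by
    one, since only the first pair contains [r]. *)
Lemma spanned_unit2_q : spanned (fun=> 0%R) (fun w => (w == q)%:Z).
Proof.
have [A AB [[u [ui uq AE]]|[]]] := branch_in_B q_inner; last first.
  by have [h hi hq] := q_has_inner => /(_ _ hi).
have ur := inner_root ui; have uq' : u != q by rewrite -uq eq_sym par_neq.
have ru : r != u by rewrite eq_sym.
apply: spanned_ext (spanned_comb (-1) (spanned_mem AB) (spanned_mem (par_in_B ui))) _ => w wi.
rewrite AE uq par_q /co1 /co2; have [_|wq] := eqVneq w q.
  split=> //; rewrite /lam !inE eqxx [r == u]eq_sym (negbTE ur) [r == q]eq_sym (negbTE q_root).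
  rewrite (eq_bigr (fun w => cnt w [set u; q])); first by rewrite /= !PoszD; ring.
  move=> v /andP[vr vq]; rewrite !cnt2 //.
  by rewrite [anc v q]anc_parE par_q (negbTE vq) anc_root (negbTE vr) addnC.
rewrite !gam2 // !bet2 // [anc w q]anc_parE par_q (negbTE wq) anc_root (negbTE (inner_root wi)).
by case: (anc w u).
Qed.

(** The row of {q, r} is 1 in both columns at [q] and 0 elsewhere. *)
Lemma spanned_unit1_q : spanned (fun w => (w == q)%:Z) (fun=> 0%R).
Proof.
apply: spanned_ext (spanned_comb (-1) (spanned_mem (par_in_B q_inner)) spanned_unit2_q) _ => w wi.
rewrite par_q /co1 /co2; have [_|wq] := eqVneq w q.
  split=> //; rewrite /lam !inE eqxx orbT big1 // => v /andP[vr vq].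
  by rewrite cnt2 ?q_root // anc_parE par_q (negbTE vq) anc_root (negbTE vr).
by rewrite gam2 ?q_root // bet2 ?q_root // anc_parE par_q (negbTE wq) anc_root (negbTE (inner_root wi)).
Qed.

(** Both unit vectors at [q] being available, entries at [q] can be corrected at will and are
    ignored from here on. *)
Lemma spanned_off_q F G F' G' : spanned F G ->
  (forall w, w \in inner -> w != q -> F' w = F w /\ G' w = G w) -> spanned F' G'.
Proof.
move=> FG E; have := spanned_comb (G' q - G q) (spanned_comb (F' q - F q) FG spanned_unit1_q) spanned_unit2_q.
move/spanned_ext; apply=> w wi; have [->|wq] := eqVneq w q; first by split=> /=; ring.
by have [-> ->] := E w wi wq; split=> /=; ring.
Qed.

Lemma spanned_anc v : v \in inner -> spanned (fun w => (anc w v)%:Z) (fun=> 0%R).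
Proof.
move=> vi; have vr := inner_root vi; have pv : v != par v by rewrite eq_sym par_neq.
have [A AB [[u [ui uv AE]]|[_ [y [yr yv yl AE]]]]] := branch_in_B vi.
  have ur := inner_root ui.
  have puv : par v != u.
    by apply/eqP => E; have := depth_par ur; have := depth_par vr; rewrite uv E; lia.
  have uv' : u != v by rewrite -uv eq_sym par_neq.
  (* The combination is {v, par v} + {u, v} - {par v, u}. The [bet] parts are the indicators of [v],
     of [u] and of both, so they cancel; in the [gam] parts the ancestors of [v] remain. *)
  apply: spanned_off_q (spanned_comb (-1) (spanned_comb 1 (spanned_mem (par_in_B vi)) (spanned_mem (par_in_B ui))) (spanned_mem AB)) _.
  move=> w wi wq; rewrite AE uv /co1 /co2 (negbTE wq) !gam2 // !bet2 //.
  have uF : anc u v = false by rewrite -uv anc_par_self.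
  have vF := anc_par_self vr.
  rewrite [anc w u]anc_parE uv; have [->|wu] := eqVneq w u.
    by rewrite uF; move: uF; rewrite anc_parE; case: (anc u (par v)); rewrite ?orbT.
  rewrite [anc w v]anc_parE; have [->|wv] := eqVneq w v; first by rewrite vF.
  by case: (anc w (par v)).
have yv' : v != y by rewrite -yv par_neq.
(* The leaf [y] has the same inner ancestors as its parent [v], so the single row of {v, y}
   suffices. *)
apply: spanned_off_q (spanned_mem AB) _ => w wi wq.
rewrite AE /co1 /co2 (negbTE wq) gam2 // bet2 // [anc w y]anc_parE yv.
have wy : w != y by apply: contraNneq yl => <-.
by rewrite (negbTE wy); case: (anc w v).
Qed.

(** The ancestors of [v] are those of [par v] together with [v] itself. *)
Lemma spanned_unit1 v : v \in inner -> spanned (fun w => (w == v)%:Z) (fun=> 0%R).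
Proof.
move=> vi; have [->|vq] := eqVneq v q; first exact: spanned_unit1_q.
have vr := inner_root vi; have pi := par_inner vr vq.
apply: spanned_ext (spanned_comb (-1) (spanned_anc vi) (spanned_anc pi)) _ => w _.
split=> //; rewrite [anc w v]anc_parE; have [->|wv] := eqVneq w v; first by rewrite anc_par_self.
by case: (anc w (par v)).
Qed.

(** Away from [q], the row of {v, par v} has the ancestors of [par v] in its first block and the
    indicator of [v] in its second. *)
Lemma spanned_unit2 v : v \in inner -> spanned (fun=> 0%R) (fun w => (w == v)%:Z).
Proof.
move=> vi; have [->|vq] := eqVneq v q; first exact: spanned_unit2_q.
have vr := inner_root vi; have pi := par_inner vr vq.
have pv : v != par v by rewrite eq_sym par_neq.
apply: spanned_off_q (spanned_comb (-1) (spanned_mem (par_in_B vi)) (spanned_anc pi)) _.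
move=> w _ wq; rewrite /co1 /co2 (negbTE wq) gam2 // bet2 //.
rewrite [anc w v]anc_parE; have [->|wv] := eqVneq w v; first by rewrite anc_par_self.
by case: (anc w (par v)).
Qed.

End Lattice.

(** * The factorization and its determinant *)

Definition comx k (f : 'I_k -> {set V}) : 'M[int]_(k, #|inner| + #|inner|) :=
  row_mx (\matrix_(i, j) co1 (f i) (enum_val j)) (\matrix_(i, j) co2 (f i) (enum_val j)).

Definition formmx : 'M[int]_(#|inner| + #|inner|) :=
  block_mx (diag_mx (\row_j ka (enum_val j))) (diag_mx (\row_j kd (enum_val j)))
           (diag_mx (\row_j kd (enum_val j))) 0.

Lemma max4pc_mx k n (f : 'I_k -> {set V}) (g : 'I_n -> {set V}) :
  (forall i, f i \in two_sets V) -> (forall j, g j \in two_sets V) ->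
  \matrix_(i, j) (max4pc e (f i) (g j))%:R = comx f *m formmx *m (comx g)^T.
Proof.
move=> f2 g2; rewrite /comx /formmx mul_row_block tr_row_mx mul_row_col mulmx0 addr0 mulmxDl.
apply/matrixP => i j; rewrite !mxE natz max4pc_gram // big_enum_val -!big_split.
by apply: eq_bigr => x _; rewrite !mul_mx_diag !mxE /=; ring.
Qed.

Lemma det_antidiag_blocks n (A D : 'M[int]_n) :
  \det (block_mx A D D 0) = (-1) ^+ n * \det D ^+ 2.
Proof.
have -> : block_mx A D D 0 = block_mx D A 0 D *m block_mx 0 1%:M 1%:M 0.
  by rewrite mulmx_block !(mulmx0, mulmx1, mul0mx, add0r, addr0).
(* The determinant of the block swap is read off from this identity, whose other factors are
   triangular with known diagonals. *)
have sw : block_mx 1%:M 1%:M 0 1%:M *m block_mx 0 1%:M 1%:M 0 = block_mx 1%:M 0 1%:M (-1)%:M *m block_mx 1%:M 1%:M 0 (1%:M : 'M[int]_n).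
  rewrite !mulmx_block !(mulmx0, mulmx1, mul0mx, mul1mx, add0r, addr0).
  by rewrite -raddfD subrr raddf0.
have := congr1 determinant sw; rewrite !det_mulmx !det_ublock det_lblock !det1 !det_scalar !mulr1 !mul1r => ->.
by rewrite mulrC expr2.
Qed.

Lemma det_formmx : \det formmx = (-1) ^+ #|inner| * 2 ^+ (2 * (#|inner| - 1)).
Proof.
rewrite det_antidiag_blocks det_diag; congr (_ * _).
transitivity (\prod_(w in inner) kd w ^+ 2).
  by rewrite [RHS]big_enum_val prodrXl; congr (_ ^+ 2); apply: eq_bigr => i _; rewrite mxE.
rewrite (bigD1 q) //= /kd eqxx mul1r (eq_bigr (fun=> 2 ^+ 2)); last first.
  by move=> w /andP[_ wq]; rewrite (negbTE wq).
rewrite prodr_const exprM; congr (_ ^+ _).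
rewrite (cardD1 q inner) q_inner add1n subn1 /=; apply: eq_card => w.
by rewrite [LHS]unfold_in [RHS]inE /= andbC.
Qed.

Lemma comx_left_inverse (B : {set {set V}}) :
  (forall v, v \in inner -> [set v; par v] \in B) ->
  (forall v, v \in inner -> exists2 A, A \in B & branch v A) ->
  (exists2 h, h \in inner & par h = q) ->
  exists U, U *m comx (fun i : 'I_#|B| => enum_val i) = 1%:M.
Proof.
move=> pB bB qi.
have /fin_all_exists[u1 u1P] (j : 'I_#|inner|) := spanned_unit1 pB bB qi (enum_valP j).
have /fin_all_exists[u2 u2P] (j : 'I_#|inner|) := spanned_unit2 pB bB qi (enum_valP j).
exists (col_mx (\matrix_(j, i) u1 j (enum_val i)) (\matrix_(j, i) u2 j (enum_val i))).
rewrite mul_col_row [RHS]scalar_mx_block; congr block_mx; apply/matrixP => i j; rewrite !mxE.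
- under eq_bigr do rewrite !mxE.
  rewrite -(big_enum_val (A := mem B) (fun A => u1 i A * co1 A (enum_val j))).
  by have [<- _] := u1P i _ (enum_valP j); rewrite (inj_eq enum_val_inj) eq_sym; case: eqP.
- under eq_bigr do rewrite !mxE.
  rewrite -(big_enum_val (A := mem B) (fun A => u1 i A * co2 A (enum_val j))).
  by have [_ <-] := u1P i _ (enum_valP j).
- under eq_bigr do rewrite !mxE.
  rewrite -(big_enum_val (A := mem B) (fun A => u2 i A * co1 A (enum_val j))).
  by have [<- _] := u2P i _ (enum_valP j).
under eq_bigr do rewrite !mxE.
rewrite -(big_enum_val (A := mem B) (fun A => u2 i A * co2 A (enum_val j))).
by have [_ <-] := u2P i _ (enum_valP j); rewrite (inj_eq enum_val_inj) eq_sym; case: eqP.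
Qed.

Local Close Scope ring_scope.

(** * The algorithm *)

Lemma set2_eq (T : finType) (a b c d : T) :
  [set a; b] = [set c; d] -> (a = c /\ b = d) \/ (a = d /\ b = c).
Proof.
move=> E; have: a \in [set c; d] by rewrite -E !inE eqxx.
have: b \in [set c; d] by rewrite -E !inE eqxx orbT.
have: c \in [set a; b] by rewrite E !inE eqxx.
have: d \in [set a; b] by rewrite E !inE eqxx orbT.
by rewrite !inE => /orP[]/eqP h1 /orP[]/eqP h2 /orP[]/eqP h3 /orP[]/eqP h4; subst; auto.
Qed.

Lemma edge_tedges x y : e x y -> [set x; y] \in tedges e.
Proof. by move=> xy; apply/imset2P; exists x y; rewrite ?inE. Qed.

Lemma tedge_other f v : f \in tedges e -> v \in f -> exists2 u, e v u & f = [set v; u].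
Proof.
case/imset2P=> x y _; rewrite !inE /= => xy -> /set2P[] ->; first by exists y.
by exists x; [rewrite tree_sym | rewrite setUC].
Qed.

Lemma tedge_par f : f \in tedges e -> exists2 x, x != r & f = [set x; par x].
Proof.
case/imset2P=> x y _; rewrite !inE /= => /edge_par_cases[[xr ->]|[yr ->]] ->; first by exists x.
by exists y; [|rewrite setUC].
Qed.

Lemma par_tedges x : x != r -> [set x; par x] \in tedges e.
Proof. by move/par_edge/edge_tedges. Qed.

Lemma tedge_eq f u v : f \in tedges e -> u \in f -> v \in f -> u != v -> f = [set u; v].
Proof.
move=> fE uf vf uv; have [x ux E] := tedge_other fE uf.
by move: vf; rewrite E => /set2P[] vE; rewrite vE ?eqxx in uv *.
Qed.

(* The current graph of a run whose unprocessed inner vertices are [Q]; with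
   [Q = [set v]] it is the clique of all tree edges at [v]. *)
Definition LGr (Q : {set V}) : graph V :=
  Graph [set f in tedges e | [exists u in Q, u \in f]]
    [set [set a; b] | a in tedges e, b in tedges e &
       (a != b) && [exists u in Q, (u \in a) && (u \in b)]].

Definition meet_in (Q : {set V}) (a b : {set V}) : bool :=
  [&& a \in tedges e, b \in tedges e, a != b & [exists u in Q, (u \in a) && (u \in b)]].

Lemma gE_LGrP (Q : {set V}) (f : {set {set V}}) :
  reflect (exists a b, f = [set a; b] /\ meet_in Q a b) (f \in gE (LGr Q)).
Proof.
apply: (iffP imset2P) => [[a b aE]|[a [b [-> /and4P[aE bE ab abQ]]]]].
  by rewrite inE => /and3P[bE ab abQ] ->; exists a, b; rewrite /meet_in aE bE ab.
by exists a b => //; rewrite inE bE ab.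
Qed.

Lemma meet_in_sym Q a b : meet_in Q a b = meet_in Q b a.
Proof.
rewrite /meet_in andbCA [a == b]eq_sym; do 3!congr (_ && _).
by apply: eq_existsb => u; rewrite [(u \in a) && _]andbC.
Qed.

Lemma gE_LGr Q a b : ([set a; b] \in gE (LGr Q)) = meet_in Q a b.
Proof.
apply/gE_LGrP/idP => [[a' [b' [/set2_eq[[-> ->]|[-> ->]]]]]|ab] //.
  by rewrite meet_in_sym.
by exists a, b.
Qed.

Lemma meet_inP Q a b : meet_in Q a b ->
  exists u, [/\ u \in Q, u \in a, u \in b & [/\ a \in tedges e, b \in tedges e & a != b]].
Proof. by case/and4P=> aE bE ab /exists_inP[u uQ /andP[ua ub]]; exists u. Qed.

Lemma meet_in_intro (Q : {set V}) a b u : a \in tedges e -> b \in tedges e -> a != b ->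
  u \in Q -> u \in a -> u \in b -> meet_in Q a b.
Proof.
by move=> aE bE ab uQ ua ub; apply/and4P; split=> //; apply/exists_inP; exists u; rewrite // ua.
Qed.

Lemma gadj_LGr Q a b : gadj (LGr Q) a b = meet_in Q a b.
Proof.
rewrite /gadj gE_LGr !inE; case ab: (meet_in Q a b); last by rewrite !andbF.
have [u [uQ ua ub [-> -> _]]] := meet_inP ab; rewrite andbT.
by apply/andP; split; apply/exists_inP; exists u.
Qed.

(** A vertex shared by two distinct edges has two neighbours, hence is inner; and every edge has an
    inner end, [q] or the parent of its lower end. *)
Lemma linegraphE : linegraph e = LGr inner.
Proof.
have innerI a b u : a \in tedges e -> b \in tedges e -> a != b -> u \in a -> u \in b -> u \in inner.
  move=> aE bE ab ua ub; have [x ux aX] := tedge_other aE ua; have [y uy bY] := tedge_other bE ub.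
  by apply: (inner_neighbours ux uy); apply: contra_neq ab => xy; rewrite aX bY xy.
congr Graph.
  apply/setP => f; rewrite inE; case fE: (f \in tedges e) => //=; apply/esym/exists_inP.
  have [x xr ->] := tedge_par fE; have [xq|xq] := eqVneq x q.
    by exists q; rewrite // xq !inE eqxx.
  by exists (par x); [exact: par_inner | rewrite !inE eqxx orbT].
apply/setP => f; apply/imset2P/gE_LGrP => [[a b aE]|[a [b [-> /meet_inP[u [uQ ua ub [aE bE ab]]]]]]].
  rewrite inE => /and3P[bE ab /set0Pn[u]]; rewrite inE => /andP[ua ub] ->.
  by exists a, b; split=> //; apply: (meet_in_intro aE bE ab _ ua ub); apply: innerI aE bE ab ua ub.
exists a b => //; rewrite inE bE ab; apply/set0Pn; exists u; by rewrite inE ua.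
Qed.

(** * Cut vertices and blocks of the current graph *)

Lemma edge_side w f z z' : w != r -> f \in tedges e -> f != [set w; par w] ->
  z \in f -> z' \in f -> anc w z = anc w z'.
Proof.
move=> wr /tedge_par[x xr ->] nf.
have xw : anc w x = anc w (par x).
  by rewrite anc_parE; case: eqVneq => // wx; rewrite wx eqxx in nf.
by move=> /set2P[] -> /set2P[] ->.
Qed.

(** Removing a tree edge separates its two ends, and with them [a] from [b]. The graph [G] is
    general so that the lemma applies both to the current graph and to a candidate for a larger
    block. *)
Lemma cutv_edge (G : graph V) v u a b : gE G \subset gE (LGr setT) -> e v u ->
  gadj G [set v; u] a -> gadj G [set v; u] b -> v \in a -> u \in b -> cutv G [set v; u].
Proof.
move=> sub; wlog [vr ->] : v u a b / v != r /\ u = par v.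
  move=> H evu ga gb va ub; case: (edge_par_cases evu) => [E|[ur E]]; first exact: (H v u a b).
  by rewrite setUC in ga gb *; apply: (H u v b a); rewrite 1?tree_sym.
move=> _ ga gb va ub.
have nadj x y : gadj G x y -> meet_in setT x y.
  by case/and3P=> _ _ /(subsetP sub); rewrite gE_LGr.
have [_ [_ _ _ [_ aE /negbTE na]]] := meet_inP (nadj _ _ ga).
have [_ [_ _ _ [_ bE /negbTE nb]]] := meet_inP (nadj _ _ gb).
rewrite eq_sym in na; rewrite eq_sym in nb.
apply: (cutv_intro ga gb); rewrite ?na ?nb //; apply/negP => ab.
(* Deleting the edge [[set v; par v]] keeps the edges below [v] away from the others. *)
pose side (f : {set V}) := [exists z in f, anc v z].
have sideE f z : f \in tedges e -> f != [set v; par v] -> z \in f -> side f = anc v z.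
  move=> fE nf zf; apply/exists_inP/idP => [[z' z'f]|vz]; last by exists z.
  by rewrite (edge_side vr fE nf zf z'f).
have: side a = side b.
  apply: connect_invariant ab => x y; rewrite gadj_delv => /and3P[nx ny /nadj/meet_inP[z [_ zx zy [xE yE _]]]].
  by rewrite (sideE _ z) // (sideE _ z).
rewrite (sideE _ v) ?na // (sideE _ (par v)) ?nb // anc_refl.
by rewrite anc_par_self.
Qed.

Lemma subLGr (Q Q' : {set V}) : Q \subset Q' -> subgraph (LGr Q) (LGr Q').
Proof.
move=> /subsetP QQ'; split.
- apply/subsetP => f; rewrite !inE => /andP[-> /exists_inP[u uQ uf]].
  by apply/exists_inP; exists u; rewrite ?QQ'.
- apply/subsetP => f /gE_LGrP[a [b [-> /meet_inP[u [uQ ua ub [aE bE ab]]]]]].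
  by rewrite gE_LGr; apply: (meet_in_intro aE bE ab _ ua ub); apply: QQ'.
move=> f /gE_LGrP[a [b [-> /meet_inP[u [uQ ua ub [aE bE ab]]]]]].
by apply/subsetP => x /set2P[] ->; rewrite inE ?aE ?bE; apply/exists_inP; exists u.
Qed.

Lemma in_star v f : (f \in gV (LGr [set v])) = (f \in tedges e) && (v \in f).
Proof.
rewrite inE; congr (_ && _); apply/exists_inP/idP => [[u /set1P ->]//|vf].
by exists v; rewrite ?inE.
Qed.

(** All neighbours of this vertex meet it in [v], so they are pairwise adjacent without it. *)
Lemma not_cutv (Q : {set V}) v u : v != u -> u \notin Q -> ~~ cutv (LGr Q) [set v; u].
Proof.
move=> vu uQ; apply: cutv_elim => a b ac bc; rewrite !gadj_LGr.
move=> /meet_inP[z [zQ /set2P[] zE za [cE aE _]]]; last by rewrite -zE zQ in uQ.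
move=> /meet_inP[y [yQ /set2P[] yE yb [_ bE _]]]; last by rewrite -yE yQ in uQ.
have [->|ab] := eqVneq a b; first exact: connect0.
apply: connect1; rewrite gadj_delv ac bc gadj_LGr.
by apply: (meet_in_intro aE bE ab zQ za); rewrite zE -yE.
Qed.

Lemma star_nocut v : nocut (LGr [set v]).
Proof.
move=> c; case cG: (c \in gV (LGr [set v])); last by rewrite /cutv cG.
move: cG; rewrite in_star => /andP[cE vc]; have [u vu ->] := tedge_other cE vc.
by apply: not_cutv; rewrite ?inE 1?eq_sym edge_neq // tree_sym.
Qed.

Lemma star_connected v x : e v x -> gconnected (LGr [set v]).
Proof.
move=> vx; split.
  by apply/set0Pn; exists [set v; x]; rewrite in_star edge_tedges // !inE eqxx.
move=> a b; rewrite !in_star => /andP[aE va] /andP[bE vb].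
have [->|ab] := eqVneq a b; first exact: connect0.
by apply: connect1; rewrite gadj_LGr; apply: (meet_in_intro aE bE ab _ va vb); rewrite inE.
Qed.

(** A connected [H] larger than the star at [v] with an edge missing [v] would leave the star
    through some {v, z}. Since [v] is inner, there is also a neighbour {v, t} on the other side, so
    {v, z} would be a cut vertex of [H]. *)
Lemma star_block (Q : {set V}) v : v \in Q -> v \in inner -> is_block (LGr Q) (LGr [set v]).
Proof.
move=> vQ vi; have vr := inner_root vi; have vp := par_edge vr.
split; [by apply: subLGr; rewrite sub1set | exact: star_connected vp | exact: star_nocut |].
move=> H [HV HE Hf] [_ Hc] Hn sV sE.
have sub : gE H \subset gE (LGr setT).
  by apply: subset_trans HE _; have [_ ? _] := subLGr (subsetT Q).
have adjs x y : gadj (LGr [set v]) x y -> gadj H x y.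
  by case/and3P=> xV yV xy; rewrite /gadj !(subsetP sV) ?(subsetP sE).
have allv x : x \in gV H -> v \in x.
  move=> xH; apply: contraT => nvx.
  have sH : [set v; par v] \in gV H by rewrite (subsetP sV) // in_star par_tedges // !inE eqxx.
  have [|c [y [cy vc nvy]]] := connect_exit (P := fun f : {set V} => v \in f) (Hc _ _ sH xH) _ nvx.
    by rewrite !inE eqxx.
  have [z [_ zc zy [cE yE _]]] : exists z, [/\ z \in setT, z \in c, z \in y & [/\ c \in tedges e, y \in tedges e & c != y]].
    by apply: meet_inP; have /and3P[_ _ /(subsetP sub)] := cy; rewrite gE_LGr.
  have vz : v != z by apply: contraNneq nvy => ->.
  have cE' := tedge_eq cE vc zc vz.
  have evz : e v z.
    by have [u vu] := tedge_other cE vc; rewrite cE' => /set2_eq[[_ ->]|[E _]] //; rewrite E tree_irr in vu.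
  have [t tz vt] := inner_other vi evz.
  have /negP := Hn [set v; z]; case; apply: (@cutv_edge H v z [set v; t] y) => //; rewrite -?cE' //.
    apply: adjs; rewrite gadj_LGr cE'; apply: (@meet_in_intro _ _ _ v); rewrite ?edge_tedges ?inE ?eqxx //.
    by apply: contra tz => /eqP/set2_eq[[_ ->]//|[-> ->]].
  by rewrite !inE eqxx.
have VE : gV H = gV (LGr [set v]).
  apply/eqP; rewrite eqEsubset sV andbT; apply/subsetP => x xH.
  by rewrite in_star allv // andbT; have := subsetP HV _ xH; rewrite inE => /andP[].
have EE : gE H = gE (LGr [set v]).
  apply/eqP; rewrite eqEsubset sE andbT; apply/subsetP => f fH.
  have /gE_LGrP[a [b [fE /meet_inP[u [_ ua ub [aE bE ab]]]]]] := subsetP HE _ fH.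
  have /subsetP fV := Hf _ fH; rewrite fE gE_LGr.
  by apply: (@meet_in_intro _ _ _ v); rewrite ?inE ?allv ?fV // fE !inE eqxx ?orbT.
by case: H VE EE {HV HE Hf Hc Hn sV sE sub adjs allv} => /= gv ge -> ->.
Qed.

Lemma cutvE (Q : {set V}) v u : Q \subset inner -> v \in Q -> e v u ->
  cutv (LGr Q) [set v; u] = (u \in Q).
Proof.
move=> /subsetP Qi vQ vu; apply/idP/idP => [|uQ].
  by apply: contraLR => uQ; apply: not_cutv uQ; rewrite edge_neq.
have uv : e u v by rewrite tree_sym.
have [x xu vx] := inner_other (Qi _ vQ) vu; have [y yv uy] := inner_other (Qi _ uQ) uv.
have [_ sub _] := subLGr (subsetT Q).
apply: (@cutv_edge _ v u [set v; x] [set u; y] sub vu); rewrite ?gadj_LGr ?inE ?eqxx //.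
  apply: (@meet_in_intro _ _ _ v); rewrite ?edge_tedges ?inE ?eqxx //.
  by apply: contra xu => /eqP/set2_eq[[_ ->]//|[-> ->]].
apply: (@meet_in_intro _ _ _ u); rewrite ?edge_tedges ?inE ?eqxx ?orbT //.
by apply: contra yv => /eqP/set2_eq[[-> ->]//|[-> _]].
Qed.

(** The vertices deleted when the star at [v] is processed; in Step 3 these are all vertices of the
    star. *)
Definition dead (Q : {set V}) v : {set {set V}} :=
  [set f in gV (LGr [set v]) | ~~ cutv (LGr Q) f].

Lemma in_dead (Q : {set V}) v f : Q \subset inner -> v \in Q -> f \in tedges e ->
  (f \in dead Q v) = (v \in f) && ~~ [exists u in Q :\ v, u \in f].
Proof.
move=> Qi vQ fE; rewrite inE in_star fE /=; have [vf|//] := boolP (v \in f).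
have [u vu fu] := tedge_other fE vf; rewrite fu cutvE //=; congr (~~ _).
apply/idP/exists_inP => [uQ|[z]].
  by exists u; rewrite !inE ?eqxx ?orbT // uQ eq_sym edge_neq.
by rewrite !inE => /andP[zv zQ]; rewrite (negbTE zv) => /eqP <-.
Qed.

(** Two distinct tree edges share at most one vertex, so a pair meeting in [Q] away from [v] is no
    edge of the star at [v], and both members survive. *)
Lemma meet_in_setD1 (Q : {set V}) v a b : Q \subset inner -> v \in Q ->
  meet_in (Q :\ v) a b =
  [&& meet_in Q a b, ~~ meet_in [set v] a b, a \notin dead Q v & b \notin dead Q v].
Proof.
move=> Qi vQ; apply/idP/and4P => [/meet_inP[u [/setD1P[uv uQ] ua ub [aE bE ab]]]|].
  have E (f : {set V}) : u \in f -> [exists z in Q :\ v, z \in f].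
    by move=> uf; apply/exists_inP; exists u; rewrite // !inE uv.
  rewrite !in_dead // !E // !andbF; split=> //; first exact: (meet_in_intro aE bE ab uQ).
  apply/negP => /meet_inP[z [/set1P -> va vb _]]; move: ab.
  by rewrite (tedge_eq aE ua va uv) (tedge_eq bE ub vb uv) eqxx.
case=> /meet_inP[u [uQ ua ub [aE bE ab]]] nv _ _.
apply: (meet_in_intro aE bE ab _ ua ub); rewrite !inE uQ andbT.
by apply: contra nv => /eqP uv; apply: (meet_in_intro aE bE ab (set11 v)); rewrite -uv.
Qed.

Lemma LGr_setD1 (Q : {set V}) v : Q \subset inner -> v \in Q ->
  Graph (gV (LGr Q) :\: dead Q v)
        [set f in gE (LGr Q) :\: gE (LGr [set v]) | [disjoint f & dead Q v]] = LGr (Q :\ v).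
Proof.
move=> Qi vQ; congr Graph; apply/setP => f.
  rewrite in_setD [in RHS]inE; have [fE|fE] := boolP (f \in tedges e); last first.
    by rewrite [f \in gV _]inE (negbTE fE) andbF.
  rewrite in_dead // [f \in gV _]inE fE /=.
  have [/exists_inP[u /setD1P[_ uQ] uf]|no] := boolP [exists u in Q :\ v, u \in f].
    by rewrite andbF; apply/exists_inP; exists u.
  rewrite andbT; apply/andP => -[nvf /exists_inP[u uQ uf]]; case/exists_inP: no; exists u => //.
  by rewrite !inE uQ andbT; apply: contraNneq nvf => <-.
have dj a b : [disjoint [set a; b] & dead Q v] = (a \notin dead Q v) && (b \notin dead Q v).
  by rewrite disjoints_subset subUset !sub1set !in_setC.
rewrite [LHS]inE in_setD; apply/idP/gE_LGrP => [/andP[/andP[nv /gE_LGrP[a [b [fE ab]]]]]|].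
  rewrite fE dj => /andP[na nb]; exists a, b; split=> //.
  by rewrite meet_in_setD1 // ab na nb -gE_LGr -fE nv.
case=> a [b [->]]; rewrite meet_in_setD1 // => /and4P[ab nv na nb].
by rewrite dj na nb !gE_LGr ab nv.
Qed.

(** * The invariant of a run *)

(** An upper bound on the size is enough: the matching lower bound comes from the left inverse of
    [comx]. *)
Definition partial_output (Q : {set V}) (B : {set {set V}}) : Prop :=
  [/\ B \subset two_sets V, #|B| <= 2 * #|inner :\: Q| &
      forall w, w \in inner :\: Q -> [set w; par w] \in B /\ exists2 A, A \in B & branch w A].

(* Invariant at Step 1 with starting vertex [[set v; par v]]. *)
Definition frontier (Q : {set V}) v (N : {set {set V}}) : Prop :=
  [/\ Q \subset inner, v \in Q, par v \notin Q,
      (forall w, w \in inner -> par w \in Q -> w \in Q) &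
      (forall f, f \in N <-> exists w, [/\ w \in Q, par w \notin Q, w != v & f = [set w; par w]])].

Lemma branch_two_sets v A : v \in inner -> branch v A -> A \in two_sets V.
Proof.
move=> vi [[u [ui uv ->]]|[_ [y [yr yv _ ->]]]]; rewrite inE cards2; apply/eqP; congr (_.+1).
  apply/eqP; rewrite eqb1; apply/eqP => E; have := depth_par (inner_root ui).
  by have := depth_par (inner_root vi); rewrite uv E; lia.
by apply/eqP; rewrite eqb1 -yv par_neq.
Qed.

Lemma partial_output_step (Q : {set V}) B v A : Q \subset inner -> v \in Q -> branch v A ->
  partial_output Q B -> partial_output (Q :\ v) (B :|: [set [set v; par v]; A]).
Proof.
move=> /subsetP Qi vQ vA [B2 Bc Bb]; have vi := Qi _ vQ.
have inD w : w \in inner :\: (Q :\ v) -> w = v \/ w \in inner :\: Q.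
  by rewrite !inE negb_and negbK => /andP[/orP[/eqP|-> ->]]; [left | right].
split.
- rewrite subUset B2; apply/subsetP => f /set2P[] ->; last exact: branch_two_sets vA.
  by rewrite inE cards2 [v == _]eq_sym par_neq // inner_root.
- have -> : inner :\: (Q :\ v) = v |: inner :\: Q.
    by apply/setP => w; rewrite !inE; case: (eqVneq w v) => [->|]; rewrite ?vi //=; move: vi; rewrite inE.
  rewrite cardsU1 !inE vQ /= mulnDr; apply: leq_trans (leq_card_setU _ _) _; rewrite addnC.
  by apply: leq_add => //; rewrite cards2; case: (_ != _).
move=> w /inD[->|wQ]; first by split; [|exists A]; rewrite // !inE eqxx ?orbT.
have [wB [C CB wC]] := Bb w wQ.
by split; [|exists C]; rewrite // in_setU ?wB ?CB.
Qed.

(** This identifies the second output of Step 2 with the first form of [branch]. *)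
Lemma symdiff_par u v : u != r -> par u = v -> v != r ->
  symdiff [set v; par v] [set v; u] = [set par v; u].
Proof.
move=> ur uv vr; have d1 := depth_par ur; have d2 := depth_par vr; rewrite uv in d1.
have pv : par v != v by exact: par_neq.
have uv' : u != v by apply/eqP => E; rewrite E ltnn in d1.
have pu : par v != u by apply/eqP => E; rewrite E in d2; lia.
apply/setP => w; rewrite !inE; have [->|wv] := eqVneq w v.
  by rewrite ![v == _]eq_sym (negbTE pv) (negbTE uv').
by case: (eqVneq w (par v)) => [->|_]; rewrite /= ?(negbTE pu) ?andbT ?andbF.
Qed.

Lemma unique_block_star (Q : {set V}) v H : Q \subset inner -> v \in Q ->
  unique_block (LGr Q) H [set v; par v] -> H = LGr [set v].
Proof.
move=> /subsetP Qi vQ [_ _ uH]; apply/esym/uH; first by apply: star_block; rewrite ?Qi.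
by rewrite in_star par_tedges ?inner_root ?Qi // !inE eqxx.
Qed.

Lemma star_other v c : c \in gV (LGr [set v]) -> c != [set v; par v] ->
  exists u, [/\ u != r, par u = v & c = [set v; u]].
Proof.
rewrite in_star => /andP[cE vc] cs; have [u vu cu] := tedge_other cE vc.
case: (edge_par_cases vu) => -[nr E]; first by rewrite cu E eqxx in cs.
by exists u.
Qed.

(** An inner child of [v] would still lie in [Q] and give a cut vertex of the star. So in Step 3 all
    children of [v] are leaves, and the chosen [c] has the second form of [branch]. *)
Lemma leaf_star_step (Q : {set V}) v c N : frontier Q v N ->
  (forall f, f \in gV (LGr [set v]) -> ~~ cutv (LGr Q) f) ->
  c \in gV (LGr [set v]) -> c != [set v; par v] ->
  branch v c /\ (forall u, u \in inner -> par u <> v).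
Proof.
move=> [Qi vQ pvQ up _] nc cH cs; have vi := subsetP Qi _ vQ.
have nochild u : u \in inner -> par u <> v.
  move=> ui uv; have uQ : u \in Q by apply: up; rewrite // uv.
  have vu : e v u by rewrite tree_sym -uv par_edge // inner_root.
  have := nc [set v; u]; rewrite cutvE // uQ in_star edge_tedges // !inE eqxx.
  by move=> /(_ isT).
split=> //; right; split=> //.
have [u [ur uv ->]] := star_other cH cs; exists u; split=> //.
by apply/negP => /nochild.
Qed.

(** Each step processes one inner vertex [v] and shrinks [Q] to [Q :\ v]. The set [Q] contains the
    inner children of its members, and [N] lists the parent edges of its topmost vertices other than
    [v]. *)
Lemma alg_run_output G B N s Bout : alg_run G B N s Bout -> forall Q v,
  G = LGr Q -> s = [set v; par v] -> frontier Q v N -> partial_output Q B ->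
  partial_output set0 Bout.
Proof.
elim=> {G B N s Bout} [G B N s H c Bout Hu cH cc _ IH|G B N s H c Hu nc cH cs N0
    |G B N s H c s' Bout Hu nc cH cs s'N _ IH] Q v GE sE fr po;
  have [Qi vQ pvQ up NE] := fr; have vi := subsetP Qi _ vQ; have vr := inner_root vi;
  subst G s; have HE := unique_block_star Qi vQ Hu; subst H.
- have cs : c != [set v; par v].
    by apply: contraTneq cc => ->; rewrite cutvE // par_edge.
  have [u [ur uv cE]] := star_other cH cs.
  have vu : e v u by rewrite tree_sym -uv par_edge.
  have uQ : u \in Q by move: cc; rewrite cE cutvE.
  have ui := subsetP Qi _ uQ; have unv : u != v by rewrite eq_sym edge_neq.
  apply: (IH (Q :\ v) u).
  + exact: LGr_setD1.
  + by rewrite cE uv setUC.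
  + split; rewrite ?in_setD1 ?unv ?uv ?eqxx //.
    * exact: subset_trans (subD1set _ _) Qi.
    * move=> w wi; rewrite !in_setD1 => /andP[pwv pwQ]; rewrite up // andbT.
      by apply: contraNneq pvQ => <-.
    (* The topmost vertices after [v] is removed are the old ones and the inner children of [v]. The
       edges to those children are the cut vertices of the star; the chosen child [u] is the next
       start. *)
    * move=> f; rewrite in_setU; split.
        case/orP=> [/NE[w [wQ pwQ wv fE]]|].
          exists w; rewrite !in_setD1 wv wQ (negbTE pwQ) andbF; split=> //.
          by apply: contraNneq pwQ => ->; rewrite uv.
        rewrite inE => /and3P[fH fc fnc].
        have fs : f != [set v; par v].
          by apply: contraTneq fc => ->; rewrite cutvE // par_edge.
        have [w [wr wv fE]] := star_other fH fs.
        have vw : e v w by rewrite tree_sym -wv par_edge.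
        exists w; move: fc; rewrite fE cutvE // !in_setD1 wv eqxx => ->.
        rewrite eq_sym edge_neq //; split=> //; last by rewrite setUC.
        by apply: contra fnc => /eqP wu; rewrite fE cE wu.
      case=> w []; rewrite !in_setD1 => /andP[wv wQ] npw wu fE.
      have wi := subsetP Qi _ wQ; have wr := inner_root wi.
      have [pwv|pwv] := eqVneq (par w) v; last first.
        by apply/orP; left; apply/NE; exists w; rewrite pwv in npw; split.
      apply/orP; right; rewrite inE fE pwv setUC.
      have vw : e v w by rewrite tree_sym -pwv par_edge.
      rewrite in_star edge_tedges // cutvE // wQ !inE eqxx /= cE.
      by apply: contra wu => /eqP/set2_eq[[_ ->]|[-> ->]].
  + rewrite cE symdiff_par //; apply: partial_output_step => //.
    by left; exists u.
- have [vc nochild] := leaf_star_step fr nc cH cs.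
  have [B2 Bc Bb] := partial_output_step Qi vQ vc po.
  (* Since [N] is empty, the parent of any other vertex of [Q] is in [Q] too, and it is not [v],
     which has no inner child. Climbing thus never ends, contradicting the decrease of depth. *)
  have Q0 : Q :\ v = set0.
    apply/eqP; rewrite -subset0; apply/subsetP => w.
    have [n] := ubnP (depth w); elim: n w => // n IH w dw /setD1P[wv wQ].
    have wi := subsetP Qi _ wQ; have wr := inner_root wi.
    have [pwQ|pwQ] := boolP (par w \in Q); last first.
      have : [set w; par w] \in N by apply/NE; exists w; split.
      by rewrite N0 inE.
    have dp := depth_par wr.
    have: par w \in set0; last by rewrite inE.
    apply: (IH _ (leq_trans dp dw)); rewrite in_setD1 pwQ andbT.
    by apply/eqP; exact: nochild.
  by rewrite -Q0.
have [vc nochild] := leaf_star_step fr nc cH cs.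
have /NE[w [wQ pwQ wv s'E]] := s'N.
have wi := subsetP Qi _ wQ; have wr := inner_root wi.
apply: (IH (Q :\ v) w) => //.
(* Step 3 deletes the whole star, and its edges disappear with its vertices, so the resulting graph
   is the one given by [LGr_setD1]. *)
- have deadE : dead Q v = gV (LGr [set v]).
    apply/setP => f; rewrite [LHS]inE; case fH: (f \in gV (LGr [set v])) => //=.
    exact: nc.
  rewrite -LGr_setD1 // deadE; congr Graph; apply/setP => f.
  rewrite [LHS]inE [RHS]inE in_setD; case fd: [disjoint f & _]; last by rewrite !andbF.
  rewrite !andbT; case fG: (f \in gE (LGr Q)); last by rewrite andbF.
  rewrite andbT; apply/esym; apply: contraTN fd => /gE_LGrP[a [b [-> /meet_inP[u [/set1P -> va vb [aE bE ab]]]]]].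
  by rewrite disjoints_subset subUset !sub1set in_setC in_star aE va.
- split; rewrite ?in_setD1 ?wv ?(negbTE pwQ) ?andbF //.
  + exact: subset_trans (subD1set _ _) Qi.
  + move=> z zi; rewrite !in_setD1 => /andP[pzv pzQ]; rewrite up // andbT.
    by apply: contraNneq pvQ => <-.
  + move=> f; split.
      case/setD1P=> fs' /NE[z [zQ pzQ zv fE]].
      exists z; rewrite !in_setD1 zv zQ (negbTE pzQ) andbF; split=> //.
      by apply: contraNneq fs' => zw; rewrite fE s'E zw.
    case=> z []; rewrite !in_setD1 => /andP[zv zQ] npz zw fE.
    have zi := subsetP Qi _ zQ.
    have pzv : par z != v by apply/eqP; exact: nochild.
    rewrite pzv in npz; apply/andP; split; last by apply/NE; exists z.
    rewrite fE s'E; apply: contra zw => /eqP/set2_eq[[-> _]//|[zE _]].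
    by move: pwQ; rewrite -zE zQ.
exact: partial_output_step.
Qed.

(** Initially all inner vertices are unprocessed and [q] is the only topmost one, as any other inner
    vertex has an inner parent. *)
Lemma alg_output_partial B :
  alg_run (linegraph e) set0 set0 [set r; q] B -> partial_output set0 B.
Proof.
move=> run; apply: (alg_run_output run (Q := inner) (v := q)).
- exact: linegraphE.
- by rewrite par_q setUC.
- split; rewrite ?par_q ?root_not_inner // => f; rewrite inE; split=> // -[w [wi pwi wq _]].
  by rewrite par_inner ?inner_root in pwi.
by split; rewrite ?sub0set ?cards0 // setDv // => w; rewrite inE.
Qed.

End LeafRoot.
End RootedTree.

(** * Determinant and row space *)

Local Open Scope ring_scope.

(** Over the integers a left inverse forces the determinant of [Y] to be 1 or -1, and it enters
    squared. *)
Lemma det_unimodular_congruence k n (Y : 'M[int]_(k, n)) (U : 'M_(n, k)) (K : 'M_n) :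
  k = n -> U *m Y = 1%:M -> \det (Y *m K *m Y^T) = \det K.
Proof.
move=> kn; subst k => UY; have := congr1 determinant UY.
rewrite det1 det_mulmx !det_mulmx det_tr => UY1.
have /orP[] : (\det Y == 1) || (\det Y == -1).
  by have : \det Y \is a GRing.unit by apply/unitrPr; exists (\det U); rewrite mulrC.
- by move/eqP->; rewrite mul1r mulr1.
by move/eqP->; rewrite mulN1r mulrN1 opprK.
Qed.

Local Close Scope ring_scope.

Theorem theorem2 (V : finType) (e : rel V) (B : {set {set V}}) :
  is_tree e -> 4 <= #|V| -> ~ is_star e -> alg_output e B ->
  [/\ #|B| = (2 * (#|V| - nleaves e))%N,
      B \subset two_sets V,
      (forall R : numFieldType,
         row_free (Max4PC_rows e R B) && (Max4PC_rows e R B == Max4PC e R)%MS) &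
      (\det (Max4PC_BB e int B))%R
        = ((-1) ^+ (#|V| - nleaves e) * 2 ^+ (2 * (#|V| - nleaves e - 1)))%R].
Proof.
move=> te _ nstar [l [q [ll lq run]]].
have q_child := inner_child_q te ll lq nstar.
have qi : q \in inner e.
  have [h hi hq] := q_child; have hl := inner_root ll hi.
  have hnq : h != q by rewrite -hq eq_sym par_neq.
  by have := par_inner te ll lq hl hnq; rewrite hq.
have [B2 Bc Bb] := alg_output_partial te ll lq qi run.
rewrite setD0 in Bc Bb.
have mE : #|V| - nleaves e = #|inner e|.
  rewrite -(cardsC (inner e)) /nleaves (_ : ~: inner e = [set x | leaf e x]) ?addnK //.
  by apply/setP => x; rewrite !inE negbK.
have [U UY] := comx_left_inverse ll lq qi (fun v vi => (Bb v vi).1) (fun v vi => (Bb v vi).2) q_child.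
set Y := comx _ _ _ _ in UY.
(* The run bounds the size from above; the left inverse [U] of [Y] bounds it from below. *)
have cardB : #|B| = #|inner e| + #|inner e|.
  by apply/eqP; rewrite eqn_leq (mulmx1_min UY) andbT addnn -mul2n.
have memB (i : 'I_#|B|) : enum_val i \in two_sets V by apply: (subsetP B2); exact: enum_valP.
have memV (i : 'I_#|two_sets V|) : enum_val i \in two_sets V by exact: enum_valP.
have BBE : Max4PC_BB e int B = (Y *m formmx e q *m Y^T)%R.
  exact: (max4pc_mx te ll lq qi memB memB).
have detBB : (\det (Max4PC_BB e int B))%R = ((-1) ^+ #|inner e| * 2 ^+ (2 * (#|inner e| - 1)))%R.
  by rewrite BBE (det_unimodular_congruence _ cardB UY) (det_formmx qi).
split; rewrite ?mE //; first by rewrite cardB addnn mul2n.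
move=> R; pose toR n p (M : 'M[int]_(n, p)) : 'M[R]_(n, p) := map_mx intr M.
(* Position of each element of [B] among all pairs, so that submatrices become products with
   selection matrices and rank inequalities apply. *)
pose sel (j : 'I_#|B|) := enum_rank_in (memB j) (enum_val j).
have selE j : enum_val (sel j) = enum_val j by rewrite enum_rankK_in.
have BBsel : Max4PC_BB e R B = (Max4PC_rows e R B *m colsub sel 1%:M)%R.
  by rewrite mulmx_colsub mulmx1; apply/matrixP => i j; rewrite !mxE selE.
have rowsel : Max4PC_rows e R B = (rowsub sel 1%:M *m Max4PC e R)%R.
  by rewrite mul_rowsub_mx mul1mx; apply/matrixP => i j; rewrite !mxE selE.
apply/and3P; split.
(* In characteristic 0 the nonzero integer determinant stays nonzero, so the rows already have full
   rank on the columns in [B]. *)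
- have : (Max4PC_BB e R B \in unitmx)%R.
    have -> : Max4PC_BB e R B = toR _ _ (Max4PC_BB e int B).
      by apply/matrixP => i j; rewrite !mxE rmorph_nat.
    rewrite unitmxE det_map_mx detBB unitfE intr_eq0.
    by rewrite mulf_neq0 // expf_neq0.
  rewrite -row_free_unit BBsel => /eqP full.
  by rewrite /row_free eqn_leq rank_leq_row -{1}full mxrankM_maxl.
- by rewrite rowsel submxMl.
pose Z := comx l te q (fun i : 'I_#|two_sets V| => enum_val i).
(* The full matrix is Z K Z^T with K the matrix [formmx], and Z = (Z U) Y because U Y = 1. So every
   row is a combination, with coefficients in Z U, of the rows Y K Z^T at [B]. *)
have -> : Max4PC e R = (toR _ _ (Z *m U) *m Max4PC_rows e R B)%R; last exact: submxMl.
have -> : Max4PC_rows e R B = toR _ _ (Y *m formmx e q *m Z^T)%R.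
  rewrite -(max4pc_mx te ll lq qi memB memV).
  by apply/matrixP => i j; rewrite !mxE rmorph_nat.
rewrite -map_mxM !mulmxA -(mulmxA Z U) UY mulmx1 -(max4pc_mx te ll lq qi memV memV).
by apply/matrixP => i j; rewrite !mxE rmorph_nat.
Qed.
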